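(* Consider one quadrature point on a moving-wall face $f$, with outward-oriented scaled physical normal $(\mathcal{M}_{1,f},\mathcal{M}_{2,f},\mathcal{M}_{3,f})\neq 0$, surface Jacobian $\mathcal{J}_f=(\sum_{m=1}^3\mathcal{M}_{m,f}^2)^{1/2}$, unit normal $\mathbf{n}_f=(\mathcal{M}_{m,f}/\mathcal{J}_f)_{m=1,2,3}$, arbitrary grid velocity $\mathbf{V}_f\in\mathbb{R}^3$, and wall velocity $\mathbf{u}_{w,f}=\mathbf{V}_f$. Let the interior state at this point have density $\rho_f^->0$, velocity $\mathbf{u}_f^-\in\mathbb{R}^3$ and temperature $T_f^->0$, with conservative variables $\mathbf{q}_f^-$ and entropy variables $\mathbf{w}_f^-$. Let the boundary (ghost) state $\mathbf{q}_f^B$ be the conservative state with primitive variables $$\rho_f^B=\rho_f^-,\qquad \mathbf{u}_f^B=\mathbf{u}_f^--2\left[(\mathbf{u}_f^--\mathbf{u}_{w,f})\cdot\mathbf{n}_f\right]\mathbf{n}_f,\qquad T_f^B=T_f^- .$$ Let the boundary ALE penalty be $$\mathbf{g}_f^{(\mathrm{B,ALE}),q}=\widetilde{\mathbf{f}}_f^{\,\mathrm{ALE},-}-\widetilde{\mathbf{f}}_f^{\,\mathrm{ALE,bc}},\qquad \widetilde{\mathbf{f}}_f^{\,\mathrm{ALE},-}=\sum_{m=1}^3\mathcal{M}_{m,f}\left[\mathbf{F}_{x_m}(\mathbf{q}_f^-)-V_{m,f}\mathbf{q}_f^-\right],\qquad \widetilde{\mathbf{f}}_f^{\,\mathrm{ALE,bc}}=\sum_{m=1}^3\mathcal{M}_{m,f}\,\mathbf{F}_{x_m}^{\mathrm{ALE,ec}}(\mathbf{q}_f^-,\mathbf{q}_f^B;V_{m,f}),$$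 where $\mathbf{F}_{x_m}$ is the inviscid flux and $\mathbf{F}_{x_m}^{\mathrm{ALE,ec}}$ is the two-point entropy-conservative ALE flux of Chandrashekar type. Then the ALE penalty contribution is entropy conservative, i.e. the pointwise ALE inviscid wall contribution to the semi-discrete entropy balance vanishes: $$(\mathbf{w}_f^-)^\top\mathbf{g}_f^{(\mathrm{B,ALE}),q}-\widetilde{F}_{S,f}^{\,\mathrm{ALE},-}=0,$$ where $\widetilde{F}_{S,f}^{\,\mathrm{ALE},-}=\sum_{m=1}^3\mathcal{M}_{m,f}\left[F_{S,x_m}(\mathbf{q}_f^-)-V_{m,f}S(\mathbf{q}_f^-)\right]$ is the outward-oriented ALE entropy flux of the interior state.
   Context: Gas model. $R>0$ gas constant, $\gamma>1$, $c_v=R/(\gamma-1)$, $c_p=\gamma R/(\gamma-1)$. For a primitive state $(\rho,\mathbf{u},T)$ with $\rho,T>0$: pressure $p=\rho RT$, $E=c_vT+\frac12|\mathbf{u}|^2$, $H=c_pT+\frac12|\mathbf{u}|^2$, conservative variables $\mathbf{q}=(\rho,\rho\mathbf{u},\rho E)$, inviscid flux $\mathbf{F}_{x_m}(\mathbf{q})=(\rho u_m,\ \rho u_m u_1+\delta_{m1}p,\ \rho u_mu_2+\delta_{m2}p,\ \rho u_mu_3+\delta_{m3}p,\ \rho u_mH)^\top$. Entropy. $s=\frac{R}{\gamma-1}\log(T/T_\infty)-R\log(\rho/\rho_\infty)$ with constants $T_\infty,\rho_\infty>0$; mathematical entropy $S=-\rho s$; entropy flux $F_{S,x_m}=-\rho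 u_m s$; entropy variables $\mathbf{w}=\left(\frac{H-|\mathbf{u}|^2}{T}-s,\ \frac{u_1}{T},\frac{u_2}{T},\frac{u_3}{T},\ -\frac1T\right)^\top$. Averages of two states $a_i,a_j$: arithmetic $[\![a]\!]=\frac{a_i+a_j}{2}$; logarithmic $[\![a]\!]^{\log}=\frac{a_i-a_j}{\log a_i-\log a_j}$ for $a_i\ne a_j$, extended continuously by $[\![a]\!]^{\log}=a_i$ if $a_i=a_j$. Two-point flux. With $\beta=\rho/(2p)=1/(2RT)$, and $V_m$ the (averaged) grid velocity component, $$\mathbf{F}_{x_m}^{\mathrm{ALE,ec}}=\begin{bmatrix}[\![\rho]\!]^{\log}([\![u_m]\!]-V_m)\\ [\![\rho]\!]^{\log}([\![u_m]\!]-V_m)[\![u_1]\!]+\frac{[\![\rho]\!]}{2[\![\beta]\!]}\delta_{m,1}\\ [\![\rho]\!]^{\log}([\![u_m]\!]-V_m)[\![u_2]\!]+\frac{[\![\rho]\!]}{2[\![\beta]\!]}\delta_{m,2}\\ [\![\rho]\!]^{\log}([\![u_m]\!]-V_m)[\![u_3]\!]+\frac{[\![\rho]\!]}{2[\![\beta]\!]}\delta_{m,3}\\ [\![\rho]\!]^{\log}([\![u_m]\!]-V_m)\Big(\frac{1}{2(\gamma-1)[\![\beta]\!]^{\log}}+\overline{k}\Big)+\frac{[\![\rho]\!]\,[\![u_m]\!]}{2[\![\beta]\!]}\end{bmatrix},\qquad \overline{k}=\frac12\sum_{r=1}^3\left(2[\![u_r]\!]^2-[\![u_r^2]\!]\right).$$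 Role of the quantities. In the diagonal-norm SBP discretization of the ALE compressible Navier--Stokes equations on a hexahedral element, boundary conditions are imposed weakly by adding penalty (SAT) vectors $\mathbf{g}_f$ at the face nodes. $\mathcal{M}_{m,f}=n_{\xi_l,f}\,J\,\partial\xi_l/\partial x_m$ at the face node, where $\xi_l$ is the reference direction orthogonal to $f$, $n_{\xi_l,f}\in\{-1,+1\}$ is the outward reference normal and $J$ the mapping Jacobian. Contracting the scheme with the entropy variables (under the discrete geometric conservation laws) leaves, at each wall node, the ALE inviscid contribution $(\mathbf{w}_f^-)^\top\mathbf{g}_f^{(\mathrm{B,ALE}),q}-\widetilde{F}_{S,f}^{\,\mathrm{ALE},-}$ to the rate of change of the discrete total mathematical entropy, plus purely viscous terms; the ALE penalty is called entropy conservative if this contribution is zero. *)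

(* Defs.v *)
From HB Require Import structures.
From mathcomp Require Import all_boot all_order all_algebra.
From mathcomp Require Import all_classical all_reals all_analysis.

Set Implicit Arguments.
Unset Strict Implicit.
Unset Printing Implicit Defensive.

Import Order.TTheory GRing.Theory Num.Theory.
Local Open Scope ring_scope.

Record gas (K : realType) := Gas {
  gasR : K;
  gamma : K;
  Tinf : K;
  rhoinf : K;
  gasR_gt0 : 0 < gasR;
  gamma_gt1 : 1 < gamma;
  Tinf_gt0 : 0 < Tinf;
  rhoinf_gt0 : 0 < rhoinf }.

Definition cv {K : realType} (g : gas K) : K := gasR g / (gamma g - 1).
Definition cp {K : realType} (g : gas K) : K :=
  gamma g * gasR g / (gamma g - 1).

Definition dot {K : realType} {n : nat} (a b : 'cV[K]_n) : K :=
  \sum_(i < n) a i 0 * b i 0.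

(* A vector of R^5 is stored in blocks: mass, momentum (3 components), energy. *)
Definition vec5 (K : realType) := 'cV[K]_(1 + (3 + 1)).
Definition mkvec5 {K : realType} (a : K) (b : 'cV[K]_3) (c : K) : vec5 K :=
  col_mx a%:M (col_mx b c%:M).

Record prim (K : realType) := Prim {
  prho : K;
  pvel : 'cV[K]_3;
  ptemp : K }.

Definition cons_of_prim {K : realType} (g : gas K) (W : prim K) : vec5 K :=
  let E := cv g * ptemp W + dot (pvel W) (pvel W) / 2 in
  mkvec5 (prho W) (prho W *: pvel W) (prho W * E).

(* The primitive variables as functions of the conservative state
   q = (rho, rho u, rho E); [cons_of_primK] below justifies the formulas. *)
Definition rho {K : realType} (q : vec5 K) : K := usubmx q 0 0.
Definition vel {K : realType} (q : vec5 K) : 'cV[K]_3 :=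
  (rho q)^-1 *: usubmx (dsubmx q).
Definition totE {K : realType} (q : vec5 K) : K :=
  dsubmx (dsubmx q) 0 0 / rho q.
Definition temp {K : realType} (g : gas K) (q : vec5 K) : K :=
  (totE q - dot (vel q) (vel q) / 2) / cv g.

Lemma cons_of_primK (K : realType) (g : gas K) (W : prim K) :
  0 < prho W ->
  [/\ rho (cons_of_prim g W) = prho W, vel (cons_of_prim g W) = pvel W
    & temp g (cons_of_prim g W) = ptemp W].
Proof.
move=> r0; have rn0 : prho W != 0 by rewrite gt_eqF.
have cn0 : cv g != 0.
  by rewrite gt_eqF// divr_gt0 ?gasR_gt0// subr_gt0 gamma_gt1.
have er : rho (cons_of_prim g W) = prho W.
  by rewrite /rho col_mxKu mxE eqxx mulr1n.
have ev : vel (cons_of_prim g W) = pvel W.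
  by rewrite /vel er col_mxKd col_mxKu scalerA mulVf// scale1r.
split=> //; rewrite /temp ev /totE er !col_mxKd mxE eqxx mulr1n.
by rewrite mulrAC mulfV// mul1r addrK mulrAC mulfV// mul1r.
Qed.

Definition pressure {K : realType} (g : gas K) (q : vec5 K) : K :=
  rho q * gasR g * temp g q.
Definition enthalpy {K : realType} (g : gas K) (q : vec5 K) : K :=
  cp g * temp g q + dot (vel q) (vel q) / 2.

Definition flux {K : realType} (g : gas K) (m : 'I_3) (q : vec5 K) : vec5 K :=
  let um := vel q m 0 in
  mkvec5 (rho q * um)
         (\col_r (rho q * um * vel q r 0 + (m == r)%:R * pressure g q))
         (rho q * um * enthalpy g q).

Definition spec_entropy {K : realType} (g : gas K) (q : vec5 K) : K :=
  gasR g / (gamma g - 1) * ln (temp g q / Tinf g)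
  - gasR g * ln (rho q / rhoinf g).
Definition math_entropy {K : realType} (g : gas K) (q : vec5 K) : K :=
  - rho q * spec_entropy g q.
Definition entropy_flux {K : realType} (g : gas K) (m : 'I_3) (q : vec5 K) : K :=
  - rho q * vel q m 0 * spec_entropy g q.
Definition entropy_var {K : realType} (g : gas K) (q : vec5 K) : vec5 K :=
  mkvec5 ((enthalpy g q - dot (vel q) (vel q)) / temp g q - spec_entropy g q)
         ((temp g q)^-1 *: vel q)
         (- (temp g q)^-1).

Definition avg {K : realType} (a b : K) : K := (a + b) / 2.
Definition logavg {K : realType} (a b : K) : K :=
  if a == b then a else (a - b) / (ln a - ln b).

Definition beta {K : realType} (g : gas K) (q : vec5 K) : K :=
  rho q / (2 * pressure g q).

Definition kbar {K : realType} (qi qj : vec5 K) : K :=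
  2^-1 * \sum_(r < 3) (2 * avg (vel qi r 0) (vel qj r 0) ^+ 2
                       - avg (vel qi r 0 ^+ 2) (vel qj r 0 ^+ 2)).

Definition flux_ale_ec {K : realType} (g : gas K) (m : 'I_3)
    (qi qj : vec5 K) (Vm : K) : vec5 K :=
  let au (r : 'I_3) := avg (vel qi r 0) (vel qj r 0) in
  let mass := logavg (rho qi) (rho qj) * (au m - Vm) in
  let arho := avg (rho qi) (rho qj) in
  let abeta := avg (beta g qi) (beta g qj) in
  mkvec5 mass
         (\col_r (mass * au r + arho / (2 * abeta) * (m == r)%:R))
         (mass * ((2 * (gamma g - 1) * logavg (beta g qi) (beta g qj))^-1
                  + kbar qi qj)
          + arho * au m / (2 * abeta)).

Definition surf_jac {K : realType} (M : 'cV[K]_3) : K :=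
  Num.sqrt (\sum_(m < 3) M m 0 ^+ 2).
Definition unit_normal {K : realType} (M : 'cV[K]_3) : 'cV[K]_3 :=
  \col_m (M m 0 / surf_jac M).

Definition wall_ghost {K : realType} (n uw : 'cV[K]_3) (W : prim K) : prim K :=
  Prim (prho W) (pvel W - (2 * dot (pvel W - uw) n) *: n) (ptemp W).

Definition ale_normal_flux {K : realType} (g : gas K) (M V : 'cV[K]_3)
    (q : vec5 K) : vec5 K :=
  \sum_(m < 3) M m 0 *: (flux g m q - V m 0 *: q).
Definition ale_bc_flux {K : realType} (g : gas K) (M V : 'cV[K]_3)
    (q qB : vec5 K) : vec5 K :=
  \sum_(m < 3) M m 0 *: flux_ale_ec g m q qB (V m 0).
Definition ale_penalty {K : realType} (g : gas K) (M V : 'cV[K]_3)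
    (q qB : vec5 K) : vec5 K :=
  ale_normal_flux g M V q - ale_bc_flux g M V q qB.
Definition ale_entropy_flux {K : realType} (g : gas K) (M V : 'cV[K]_3)
    (q : vec5 K) : K :=
  \sum_(m < 3) M m 0 * (entropy_flux g m q - V m 0 * math_entropy g q).

(* Main.v *)
(** The ghost velocity is the reflection of the interior velocity in the moving
    wall, so the averaged velocity has no mass flux relative to the wall and the
    two-point flux reduces to the wall pressure load [(0, p M, p (M . V))].
    Relative to it, the interior flux only carries the mass flux
    [rho ((u - V) . M)] and the pressure work [p ((u - V) . M)]; contracted with
    the entropy variables, these leave [- rho s ((u - V) . M)], which is the ALE
    entropy flux. *)

Require Import Defs.
From mathcomp Require Import all_boot all_order all_algebra.
From mathcomp Require Import all_classical all_reals all_analysis.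
From mathcomp Require Import ring.

Import Order.TTheory GRing.Theory Num.Theory.

Local Open Scope ring_scope.

Section Dot.
Variables (K : realType) (n : nat).
Implicit Types a b c : 'cV[K]_n.

Lemma dotC a b : dot a b = dot b a.
Proof. by apply: eq_bigr => i _; rewrite mulrC. Qed.

Lemma dotDr a b c : dot a (b + c) = dot a b + dot a c.
Proof. by rewrite -big_split; apply: eq_bigr => i _; rewrite mxE mulrDr. Qed.

Lemma dotZr k a b : dot a (k *: b) = k * dot a b.
Proof.
by rewrite /dot mulr_sumr; apply: eq_bigr => i _; rewrite mxE mulrCA.
Qed.

Lemma dotBr a b c : dot a (b - c) = dot a b - dot a c.
Proof. by rewrite dotDr -scaleN1r dotZr mulN1r. Qed.

Lemma dotZl k a b : dot (k *: a) b = k * dot a b.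
Proof. by rewrite dotC dotZr dotC. Qed.

Lemma sum_mul_delta (k : 'I_n -> K) (r : 'I_n) :
  \sum_m k m * (m == r)%:R = k r.
Proof.
rewrite (bigD1 r) //= eqxx mulr1 big1 ?addr0 // => m /negbTE->.
by rewrite mulr0.
Qed.

End Dot.

Section Vec5.
Variable K : realType.
Implicit Types (a c k : K) (b : 'cV[K]_3).

Lemma dot_mkvec5 a1 b1 c1 a2 b2 c2 :
  dot (mkvec5 a1 b1 c1) (mkvec5 a2 b2 c2) = a1 * a2 + dot b1 b2 + c1 * c2 :> K.
Proof.
rewrite /dot /mkvec5 big_split_ord /= big_split_ord /= !big_ord1 addrA.
congr (_ + _ + _); first by rewrite !col_mxEu !mxE eqxx !mulr1n.
  by apply: eq_bigr => i _; rewrite !(col_mxEd, col_mxEu).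
by rewrite !col_mxEd !mxE eqxx !mulr1n.
Qed.

Lemma mkvec5D a1 b1 c1 a2 b2 c2 :
  mkvec5 a1 b1 c1 + mkvec5 a2 b2 c2
  = mkvec5 (a1 + a2) (b1 + b2) (c1 + c2) :> vec5 K.
Proof. by rewrite /mkvec5 !add_col_mx !raddfD. Qed.

Lemma mkvec5Z k a b c :
  k *: mkvec5 a b c = mkvec5 (k * a) (k *: b) (k * c) :> vec5 K.
Proof. by rewrite /mkvec5 !scale_col_mx !scale_scalar_mx. Qed.

Lemma mkvec5B a1 b1 c1 a2 b2 c2 :
  mkvec5 a1 b1 c1 - mkvec5 a2 b2 c2
  = mkvec5 (a1 - a2) (b1 - b2) (c1 - c2) :> vec5 K.
Proof. by rewrite -scaleN1r mkvec5Z mkvec5D !mulN1r scaleN1r. Qed.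

Lemma mkvec5_sum n (k a c : 'I_n -> K) (b : 'I_n -> 'cV[K]_3) :
  \sum_m k m *: mkvec5 (a m) (b m) (c m)
  = mkvec5 (\sum_m k m * a m) (\sum_m k m *: b m) (\sum_m k m * c m).
Proof.
elim: n k a b c => [|n IH] k a b c; last first.
  by rewrite !big_ord_recl IH mkvec5Z mkvec5D.
by rewrite !big_ord0 /mkvec5 raddf0 !col_mx0.
Qed.

End Vec5.

Section Wall.
Variables (K : realType) (g : gas K).
Implicit Types (M V : 'cV[K]_3) (W : prim K) (q : vec5 K).

(** Removes the square root: normalizing [M] enters the wall average only through the squared
    Jacobian. *)
Lemma surf_jac_sqr M : surf_jac M ^+ 2 = dot M M.
Proof.
rewrite sqr_sqrtr; last by apply: sumr_ge0 => i _; exact: sqr_ge0.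
by apply: eq_bigr => i _; rewrite expr2.
Qed.

Lemma surf_jac_neq0 M : M != 0 -> surf_jac M != 0.
Proof.
apply: contra_neq => J0; apply/matrixP => i j; rewrite ord1 mxE.
have /eqP := surf_jac_sqr M; rewrite J0 expr0n eq_sym psumr_eq0 => [/allP H|k _].
  by have := H i (mem_index_enum i); rewrite -expr2 sqrf_eq0 => /eqP.
by rewrite -expr2 sqr_ge0.
Qed.

Lemma unit_normalE M : unit_normal M = (surf_jac M)^-1 *: M.
Proof. by apply/matrixP => i j; rewrite ord1 !mxE mulrC. Qed.

(** With [n = M / J], the mean of [u] and its reflection is [u - ((u - V) . n) n]; pairing it with
    [M] gives [M . u - ((u - V) . M) (M . M) / J^2], where the last quotient is 1. *)
Lemma wall_ghost_avg_normal M V W :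
  M != 0 ->
  \sum_(m < 3) M m 0
    * avg (pvel W m 0) (pvel (wall_ghost (unit_normal M) V W) m 0) = dot M V.
Proof.
move=> /surf_jac_neq0 J0.
transitivity (dot M (2^-1 *: (pvel W + pvel (wall_ghost (unit_normal M) V W)))).
  by apply: eq_bigr => m _; rewrite /avg [(_ + _) / 2]mulrC !mxE.
rewrite /= unit_normalE dotZr dotDr dotBr !dotZr -surf_jac_sqr.
rewrite [dot (_ - V) M]dotC dotBr; field.
exact: J0.
Qed.

(** Separates convection relative to the grid from pressure. In the energy row, [rho H = rho E + p]
    leaves the pressure work with the full velocity [u], not [u - V]. *)
Lemma ale_normal_fluxE M V W :
  0 < prho W ->
  let q := cons_of_prim g W in
  let w := prho W * (dot M (pvel W) - dot M V) in
  ale_normal_flux g M V q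
  = mkvec5 w (w *: pvel W + pressure g q *: M)
      (w * (cv g * ptemp W + dot (pvel W) (pvel W) / 2)
       + pressure g q * dot M (pvel W)).
Proof.
move=> r0 q w; have [er ev et] := cons_of_primK g r0.
have gn0 : gamma g - 1 != 0 by rewrite gt_eqF// subr_gt0 gamma_gt1.
rewrite /ale_normal_flux.
under eq_bigr do rewrite {2}/q /flux /cons_of_prim mkvec5Z mkvec5B.
rewrite mkvec5_sum /enthalpy /pressure er ev et; congr mkvec5.
- rewrite /w mulrBr /dot !mulr_sumr -sumrB; apply: eq_bigr => m _; ring.
- apply/matrixP => r j; rewrite ord1 summxE !mxE.
  rewrite (eq_bigr (fun m => prho W * (M m 0 * pvel W m 0 - M m 0 * V m 0)
      * pvel W r 0 + prho W * gasR g * ptemp W * (M m 0 * (m == r)%:R))).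
    by rewrite big_split /= -mulr_suml -!mulr_sumr sumrB sum_mul_delta.
  by move=> m _; rewrite !mxE; ring.
- rewrite /w mulrBr mulrBl /dot.
  (* Naming [u . u] shields its sum while the sums over the flux direction are merged; the remaining
     termwise identity is [cp = cv + R]. *)
  set k := \sum_(i < 3) pvel W i 0 * _.
  rewrite !mulr_sumr !mulr_suml -sumrB -big_split; apply: eq_bigr => m _ /=.
  rewrite /cv /cp; field; exact: gn0.
Qed.

(** The logarithmic means and [kbar] only multiply the relative mass flux, which cancels once summed
    against [M]; the pressure terms survive. *)
Lemma ale_bc_fluxE M V W :
  M != 0 -> 0 < prho W -> 0 < ptemp W ->
  let q := cons_of_prim g W in
  ale_bc_flux g M V q (cons_of_prim g (wall_ghost (unit_normal M) V W))
  = mkvec5 0 (pressure g q *: M) (pressure g q * dot M V).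
Proof.
move=> M0 r0 T0 q; set WB := wall_ghost _ _ _; set qB := cons_of_prim g WB.
have [er ev et] := cons_of_primK g r0.
(* The ghost keeps density and temperature, so [r0] applies to [WB] by conversion, and pressure and
   [beta] agree on both sides. *)
have [erB evB etB] : [/\ rho qB = prho W, vel qB = pvel WB
  & temp g qB = ptemp W] := cons_of_primK g (W := WB) r0.
have pB : pressure g qB = pressure g q by rewrite /pressure erB etB er et.
have bB : beta g qB = beta g q by rewrite /beta pB erB er.
have p0 : pressure g q != 0.
  by rewrite /pressure er et !mulf_neq0 ?gt_eqF ?gasR_gt0.
have rn0 : prho W != 0 by rewrite gt_eqF.
have pE : avg (rho q) (rho qB) / (2 * avg (beta g q) (beta g qB))
    = pressure g q.
  rewrite bB /beta erB er /avg; field.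
  by rewrite p0 -mulr2n mulrn_eq0.
have MV : \sum_(m < 3) M m 0 * avg (vel q m 0) (vel qB m 0) = dot M V.
  by rewrite ev evB; exact: wall_ghost_avg_normal.
(* Here [k] stands for the logarithmic density mean, which is the same for every direction [m]. *)
have no_mass k :
    \sum_(m < 3) M m 0 * (k * (avg (vel q m 0) (vel qB m 0) - V m 0)) = 0.
  under eq_bigr do rewrite mulrCA mulrBr.
  by rewrite -mulr_sumr sumrB MV subrr mulr0.
rewrite /ale_bc_flux mkvec5_sum no_mass; congr mkvec5.
- apply/matrixP => r j; rewrite ord1 summxE mxE.
  under eq_bigr do rewrite 2!mxE pE mulrDr [X in X + _]mulrA.
  rewrite big_split /= -mulr_suml no_mass mul0r add0r.
  under eq_bigr do rewrite mulrCA.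
  by rewrite -mulr_sumr sum_mul_delta.
- under eq_bigr do rewrite mulrDr [X in X + _]mulrA [X in _ + _ * X]mulrAC pE.
  rewrite big_split /= -mulr_suml no_mass mul0r add0r -MV mulr_sumr.
  by apply: eq_bigr => m _; rewrite mulrCA.
Qed.

Lemma ale_entropy_fluxE M V q :
  ale_entropy_flux g M V q
  = - (rho q * spec_entropy g q * (dot M (vel q) - dot M V)).
Proof.
rewrite /dot -sumrB mulr_sumr -sumrN; apply: eq_bigr => m _.
by rewrite /entropy_flux /math_entropy; ring.
Qed.

End Wall.

Theorem theorem4p1 (K : realType) (g : gas K) (M V uw : 'cV[K]_3)
    (W : prim K) :
  M != 0 -> uw = V -> 0 < prho W -> 0 < ptemp W ->
  let q := cons_of_prim g W in
  let qB := cons_of_prim g (wall_ghost (unit_normal M) uw W) in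
  dot (entropy_var g q) (ale_penalty g M V q qB) - ale_entropy_flux g M V q = 0.
Proof.
move=> M0 -> r0 T0 q qB; have [er ev et] := cons_of_primK g r0.
have gn0 : gamma g - 1 != 0 by rewrite gt_eqF// subr_gt0 gamma_gt1.
have Tn0 : ptemp W != 0 by rewrite gt_eqF.
rewrite /ale_penalty ale_normal_fluxE// ale_bc_fluxE// mkvec5B dot_mkvec5.
rewrite ale_entropy_fluxE addrK subr0 dotZr.
(* The mass flux has coefficient [(H - E) / T - s = R - s]; its [R] part cancels the pressure work
   [- (p / T) ((u - V) . M)], since [p / T = rho R]. *)
rewrite /enthalpy /pressure er ev et dotZl /cp /cv; field.
by rewrite Tn0 gn0.
Qed.
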